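(* Consider either the orthonormal Chebyshev polynomials of the first kind, $p_0(x)=1/\sqrt{\pi}$, $p_n(\cos\theta)=\sqrt{2/\pi}\cos(n\theta)$ for $n\ge1$ (orthonormal on $[-1,1]$ with respect to $(1-x^2)^{-1/2}dx$), whose zeros are $\zeta_j^{(n)}=\cos\big(\frac{(2j-1)\pi}{2n}\big)$, $j=1,\dots,n$; or the orthonormal Chebyshev polynomials of the second kind, $p_n(\cos\theta)=\sqrt{2/\pi}\,\frac{\sin((n+1)\theta)}{\sin\theta}$, $n\ge0$ (orthonormal with respect to $(1-x^2)^{1/2}dx$), whose zeros are $\zeta_j^{(n)}=\cos\big(\frac{j\pi}{n+1}\big)$, $j=1,\dots,n$. For $n\in\mathbb{N}$ and $y\in(-1,1)$ let $\lambda_n(y)=\big(\sum_{i=0}^{n-1}p_i^2(y)\big)^{-1}$, $\Psi_{n,j}(y)=\lambda_n(y)p_{j-1}^2(y)$ ($j=1,\dots,n$), $\mathcal S(\bm\Psi_n(y))=-\sum_{j=1}^n\Psi_{n,j}(y)\log\Psi_{n,j}(y)$, and $\mathfrak S_{n,j}=\mathcal S(\bm\Psi_n(\zeta_j^{(n)}))$. Let $x=\cos\theta\in(-1,1)$, $\theta\in(0,\pi)$. (i) If $\theta/\pi\notin\mathbb{Q}$, then (for either family) there is a sequence of pairs $(n_m,j_m)$ with $n_m\to\infty$ and $1\le j_m\le n_m$ such that $$\lim_{m\to\infty}\zeta_{j_m}^{(n_m)}=x\quad\text{and}\quad\lim_{m\to\infty}\big(\mathfrak S_{n_m,j_m}-\mathcal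 S(\bm\Psi_{n_m}(x))\big)=0.$$ (ii) If $\theta/\pi=s/k$ with $s,k\in\mathbb{N}$, $s<k$, $\operatorname{GCD}(s,k)=1$, then the conclusion of (i) still holds if the polynomials are of the second kind, or if $k$ is even. However, for the Chebyshev polynomials of the first kind with $k$ odd, $$\limsup_{n\to\infty}\big(\mathfrak S_{n,j_n}-\mathcal S(\bm\Psi_n(x))\big)<0$$ for every sequence $\{j_n\}$ with $1\le j_n\le n$ (along any subsequence of $n$).
   Context: $\operatorname{GCD}$ denotes the greatest common divisor; $\mathcal S$ is the Shannon entropy of the discrete probability distribution $\bm\Psi_n(y)=(\Psi_{n,1}(y),\dots,\Psi_{n,n}(y))$. *)

(* Defs.v *)
From Stdlib Require Import Reals Lra Lia ZArith Arith.
From Coquelicot Require Import Coquelicot.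
Open Scope R_scope.

Inductive cheb_kind := FirstKind | SecondKind.

Definition cheb_p (c : cheb_kind) (n : nat) (y : R) : R :=
  let th := acos y in
  match c with
  | FirstKind =>
      match n with
      | O => / sqrt PI
      | _ => sqrt (2 / PI) * cos (INR n * th)
      end
  | SecondKind => sqrt (2 / PI) * (sin (INR (S n) * th) / sin th)
  end.

Definition cheb_zero (c : cheb_kind) (n j : nat) : R :=
  match c with
  | FirstKind => cos ((2 * INR j - 1) * PI / (2 * INR n))
  | SecondKind => cos (INR j * PI / (INR n + 1))
  end.

Definition christoffel (c : cheb_kind) (n : nat) (y : R) : R :=
  / sum_n_m (fun i => (cheb_p c i y) ^ 2) 0%nat (n - 1)%nat.

Definition Psi (c : cheb_kind) (n j : nat) (y : R) : R :=
  christoffel c n y * (cheb_p c (j - 1) y) ^ 2.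

(* Shannon entropy S(Psi_n(y)) = - sum_{j=1}^n Psi_{n,j} log Psi_{n,j}
   (Stdlib's ln 0 = 0, so 0 log 0 = 0 as usual). *)
Definition entropy (c : cheb_kind) (n : nat) (y : R) : R :=
  - sum_n_m (fun j => Psi c n j y * ln (Psi c n j y)) 1%nat n.

Definition entropy_at_zero (c : cheb_kind) (n j : nat) : R :=
  entropy c n (cheb_zero c n j).

(* Main.v *)
(** With weights [w_i] proportional to [p_i^2(cos theta)], namely [1 + cos (2 i theta)] (but
    [w_0 = 1]) for the first kind and [1 - cos (2 (i + 1) theta)] for the second, the entropy is
    [ln W - (sum of w_i ln w_i) / W], where [W = n + O(1)] is the sum of the weights.

    If [n |theta' - theta|] is small, all [n] weights at [theta'] and [theta] are uniformly close,
    so the entropies are close.  Such zeros [cos theta'] exist by Kronecker's theorem when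
    [theta / PI] is irrational, and [theta' = theta] is possible for the second kind or even [k].

    For the gap, let [F(r)] be the sum of [(1 + cos phi) ln (1 + 2 r cos phi + r^2)] over the [M]
    points [phi] of a uniform grid.  Then [F(0) = 0], [F(1)] is [M ln 2] plus the sum of
    [(1 + cos phi) ln (1 + cos phi)], and
    [F'(r) = M + (1 - r)^2 / r^2 * (A(r) - M)], where [A(r)] is the sum of
    [(1 + r cos phi) / (1 + 2 r cos phi + r^2)].  Expanding in powers of [r] gives
    [A(r) = M / (1 - (-r)^M)], and [A(r)] is at least this if [M] is even and the grid is
    traversed several times.  Hence [F' >= M] for even [M] and [F' < M] for odd [M]: the even
    grids produced by the zeros of the first kind lie above the continuous mean [1 - ln 2] of
    [w ln w], and the odd grid produced by [theta = s PI / k] lies strictly below it. *)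

Require Import Defs.
From Stdlib Require Import Reals Lra Lia ZArith Arith IndefiniteDescription.
From Coquelicot Require Import Coquelicot.
Open Scope R_scope.

(** * Finite sums over initial segments of the natural numbers *)

Fixpoint bsum (f : nat -> R) (n : nat) : R :=
  match n with
  | O => 0
  | S m => bsum f m + f m
  end.

Lemma bsum_ext (f g : nat -> R) (n : nat) :
  (forall i, (i < n)%nat -> f i = g i) -> bsum f n = bsum g n.
Proof.
  induction n as [|n IH]; intros H; simpl; [easy|].
  rewrite IH, H; auto.
Qed.

Lemma bsum_plus (f g : nat -> R) (n : nat) :
  bsum (fun i => f i + g i) n = bsum f n + bsum g n.
Proof. induction n as [|n IH]; simpl; [lra|rewrite IH; lra]. Qed.

Lemma bsum_scal (a : R) (f : nat -> R) (n : nat) :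
  bsum (fun i => a * f i) n = a * bsum f n.
Proof. induction n as [|n IH]; simpl; [lra|rewrite IH; lra]. Qed.

Lemma bsum_const (a : R) (n : nat) : bsum (fun _ => a) n = INR n * a.
Proof.
  induction n as [|n IH]; [simpl; lra|].
  rewrite S_INR; simpl; rewrite IH; lra.
Qed.

Lemma bsum_le (f g : nat -> R) (n : nat) :
  (forall i, (i < n)%nat -> f i <= g i) -> bsum f n <= bsum g n.
Proof.
  induction n as [|n IH]; intros H; simpl; [lra|].
  apply Rplus_le_compat; auto.
Qed.

Lemma bsum_abs_le (f : nat -> R) (C : R) (n : nat) :
  (forall i, (i < n)%nat -> Rabs (f i) <= C) -> Rabs (bsum f n) <= INR n * C.
Proof.
  intros H.
  assert (Hu : bsum f n <= INR n * C).
  { rewrite <- bsum_const. apply bsum_le. intros i Hi.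
    specialize (H i Hi). apply Rabs_le_between in H. lra. }
  assert (Hl : INR n * - C <= bsum f n).
  { rewrite <- bsum_const. apply bsum_le. intros i Hi.
    specialize (H i Hi). apply Rabs_le_between in H. lra. }
  apply Rabs_le_between. lra.
Qed.

Lemma bsum_add (f : nat -> R) (n m : nat) :
  bsum f (n + m) = bsum f n + bsum (fun i => f (n + i)%nat) m.
Proof.
  induction m as [|m IH]; simpl; [rewrite Nat.add_0_r; lra|].
  rewrite Nat.add_succ_r; simpl; rewrite IH; lra.
Qed.

Lemma bsum_recl (f : nat -> R) (n : nat) :
  bsum f (S n) = f O + bsum (fun i => f (S i)) n.
Proof. change (S n) with (1 + n)%nat. rewrite bsum_add. simpl. lra. Qed.

Lemma bsum_recl_pred (f : nat -> R) (n : nat) : (0 < n)%nat ->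
  bsum f n = f O + bsum (fun i => f (S i)) (n - 1).
Proof. intros Hn. rewrite <- bsum_recl. f_equal. lia. Qed.

Lemma bsum_rev (f : nat -> R) (n : nat) :
  bsum (fun i => f (n - i)%nat) n = bsum (fun i => f (S i)) n.
Proof.
  induction n as [|n IH]; [easy|].
  rewrite bsum_recl. simpl bsum at 2. rewrite <- IH.
  rewrite Nat.sub_0_r. apply Rplus_comm.
Qed.

Lemma bsum_exchange (f : nat -> nat -> R) (n m : nat) :
  bsum (fun i => bsum (f i) m) n = bsum (fun k => bsum (fun i => f i k) n) m.
Proof.
  induction n as [|n IH]; simpl; [rewrite bsum_const; lra|].
  rewrite IH, <- bsum_plus. easy.
Qed.

Lemma sum_n_m_bsum (f : nat -> R) (a b : nat) : (a <= b)%nat ->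
  sum_n_m f a b = bsum (fun i => f (a + i)%nat) (S b - a).
Proof.
  intros Hab. replace b with (a + (b - a))%nat at 1 by lia.
  replace (S b - a)%nat with (S (b - a)) by lia.
  generalize (b - a)%nat as n. clear b Hab. induction n as [|n IH].
  - rewrite Nat.add_0_r, sum_n_n. simpl. rewrite Nat.add_0_r. lra.
  - rewrite Nat.add_succ_r, sum_n_Sm by lia. rewrite IH.
    change plus with Rplus. simpl. rewrite Nat.add_succ_r. easy.
Qed.

Lemma is_derive_bsum (f f' : nat -> R -> R) (n : nat) (r : R) :
  (forall i, (i < n)%nat -> is_derive (f i) r (f' i r)) ->
  is_derive (fun t => bsum (fun i => f i t) n) r (bsum (fun i => f' i r) n).
Proof.
  induction n as [|n IH]; intros H; simpl.
  - apply (is_derive_const (V := R_NormedModule) 0).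
  - apply (is_derive_plus (V := R_NormedModule)); auto.
Qed.

(** * Sums of cosines *)

(** Telescoping: [2 sin (b/2) cos (i b) = sin ((i + 1/2) b) - sin ((i - 1/2) b)]. *)
Lemma bsum_cos (b : R) (n : nat) :
  2 * sin (b / 2) * bsum (fun i => cos (INR i * b)) n
  = sin ((INR n - / 2) * b) + sin (b / 2).
Proof.
  induction n as [|n IH].
  - simpl. replace ((0 - / 2) * b) with (- (b / 2)) by field. rewrite sin_neg. lra.
  - rewrite S_INR. simpl bsum. rewrite Rmult_plus_distr_l, IH.
    replace ((INR n + 1 - / 2) * b) with (INR n * b + b / 2) by field.
    replace ((INR n - / 2) * b) with (INR n * b - b / 2) by field.
    rewrite sin_plus, sin_minus. lra.
Qed.

Lemma cos_Z_period (x : R) (z : Z) : cos (x + 2 * IZR z * PI) = cos x.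
Proof.
  destruct z as [|p|p].
  - f_equal; lra.
  - rewrite <- (positive_nat_Z p), <- INR_IZR_INZ. apply cos_period.
  - rewrite <- (cos_period _ (Pos.to_nat p)). f_equal.
    change (Z.neg p) with (- Z.pos p)%Z.
    rewrite opp_IZR, INR_IZR_INZ, positive_nat_Z. lra.
Qed.

Lemma sin_Z_period (x : R) (z : Z) : sin (x + 2 * IZR z * PI) = sin x.
Proof.
  rewrite !sin_cos. rewrite <- (cos_Z_period (PI / 2 + x) z). f_equal. f_equal. lra.
Qed.

(** Modulo full turns the last angle of the telescoped sum is [- b / 2], so its two sines cancel. *)
Lemma bsum_cos_grid (b : R) (M : nat) (t : Z) :
  INR M * b = 2 * IZR t * PI -> sin (b / 2) <> 0 ->
  bsum (fun i => cos (INR i * b)) M = 0.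
Proof.
  intros HM Hs.
  assert (H := bsum_cos b M).
  replace ((INR M - / 2) * b) with (- (b / 2) + 2 * IZR t * PI) in H by lra.
  rewrite sin_Z_period, sin_neg in H.
  apply (Rmult_eq_reg_l (2 * sin (b / 2))); lra.
Qed.

Lemma cos_mult_of_sin_half_eq_0 (b : R) (i : nat) : sin (b / 2) = 0 -> cos (INR i * b) = 1.
Proof.
  intros Hs. destruct (sin_eq_0_0 _ Hs) as [z Hz].
  replace (INR i * b) with (0 + 2 * IZR (Z.of_nat i * z) * PI).
  - rewrite cos_Z_period. apply cos_0.
  - rewrite mult_IZR, <- INR_IZR_INZ. replace b with (2 * (b / 2)) by field. rewrite Hz. lra.
Qed.

(** Either every term is 1 or the sum vanishes. This tolerates grids that are traversed several
    times. *)
Lemma bsum_cos_grid_ge_0 (b : R) (M : nat) (t : Z) :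
  INR M * b = 2 * IZR t * PI -> 0 <= bsum (fun i => cos (INR i * b)) M.
Proof.
  intros HM. destruct (Req_dec (sin (b / 2)) 0) as [Hs|Hs].
  - rewrite (bsum_ext _ (fun _ => 1)).
    + rewrite bsum_const. pose proof (pos_INR M). lra.
    + intros i _. now apply cos_mult_of_sin_half_eq_0.
  - rewrite (bsum_cos_grid b M t HM Hs). lra.
Qed.

Lemma bsum_cos_bounded (b : R) (n : nat) : sin (b / 2) <> 0 ->
  Rabs (bsum (fun i => cos (INR i * b)) n) <= / Rabs (sin (b / 2)).
Proof.
  intros Hs.
  assert (Hp : 0 < Rabs (sin (b / 2))) by now apply Rabs_pos_lt.
  apply (Rmult_le_reg_l (2 * Rabs (sin (b / 2)))); [lra|].
  rewrite <- (Rabs_right 2) at 1 by lra.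
  rewrite <- !Rabs_mult, bsum_cos.
  rewrite Rmult_assoc, Rinv_r by lra.
  eapply Rle_trans; [apply Rabs_triang|].
  assert (H1 := Rabs_le _ 1 (SIN_bound ((INR n - / 2) * b))).
  assert (H2 := Rabs_le _ 1 (SIN_bound (b / 2))). lra.
Qed.

(** * Mean of w ln w over a uniform grid *)

Definition xlnx (w : R) : R := w * ln w.

(** Real part of the finite geometric sum with ratio [z = - r e^(i phi)], multiplied by
    [|1 - z|^2]. *)
Lemma bsum_geom_cos (phi r : R) (n : nat) :
  (1 + 2 * r * cos phi + r ^ 2) * bsum (fun m => (- r) ^ m * cos (INR m * phi)) n
  = 1 + r * cos phi
    - (- r) ^ n * (cos (INR n * phi) + r * cos ((INR n - 1) * phi)).
Proof.
  induction n as [|n IH].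
  - simpl. replace ((0 - 1) * phi) with (- phi) by ring.
    rewrite Rmult_0_l, cos_0, cos_neg. ring.
  - rewrite S_INR. simpl bsum. rewrite Rmult_plus_distr_l, IH.
    replace ((INR n + 1 - 1) * phi) with (INR n * phi) by ring.
    replace ((INR n + 1) * phi) with (INR n * phi + phi) by ring.
    replace ((INR n - 1) * phi) with (INR n * phi - phi) by ring.
    rewrite cos_plus, cos_minus. simpl. ring.
Qed.

Lemma den_pos (c r : R) : -1 <= c -> 0 <= r < 1 -> 0 < 1 + 2 * r * c + r ^ 2.
Proof. intros Hc Hr. assert (0 <= r * (1 + c)) by nra. nra. Qed.

(** The function [A] of the overview; each summand is the real part of [1 / (1 + r e^(i phi))]. *)
Definition kernel_sum (b : R) (M : nat) (r : R) : R :=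
  bsum (fun i => (1 + r * cos (INR i * b)) / (1 + 2 * r * cos (INR i * b) + r ^ 2)) M.

(** On the grid [M phi] is a multiple of a full turn, so the remainder of the [M]-term geometric sum
    is [(- r) ^ M] times its leading part. No infinite series is required. *)
Lemma kernel_sum_eq (b r : R) (M : nat) (t : Z) :
  INR M * b = 2 * IZR t * PI -> 0 <= r < 1 ->
  (1 - (- r) ^ M) * kernel_sum b M r
  = bsum (fun m => (- r) ^ m * bsum (fun i => cos (INR i * (INR m * b))) M) M.
Proof.
  intros HM Hr. unfold kernel_sum. rewrite <- bsum_scal.
  rewrite (bsum_ext (fun m => (- r) ^ m * _)
    (fun m => bsum (fun i => (- r) ^ m * cos (INR i * (INR m * b))) M)).
  2:{ intros m _. now rewrite bsum_scal. }
  rewrite <- (bsum_exchange (fun i m => (- r) ^ m * cos (INR i * (INR m * b)))).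
  apply bsum_ext. intros i _.
  assert (HD := den_pos (cos (INR i * b)) r (proj1 (COS_bound _)) Hr).
  apply (Rmult_eq_reg_l (1 + 2 * r * cos (INR i * b) + r ^ 2)); [|lra].
  rewrite (bsum_ext _ (fun m => (- r) ^ m * cos (INR m * (INR i * b)))).
  2:{ intros m _. f_equal. f_equal. ring. }
  rewrite bsum_geom_cos.
  replace (INR M * (INR i * b)) with (0 + 2 * IZR (Z.of_nat i * t) * PI).
  2:{ rewrite mult_IZR, <- INR_IZR_INZ.
      transitivity (INR i * (2 * IZR t * PI)); [ring|rewrite <- HM; ring]. }
  replace ((INR M - 1) * (INR i * b))
    with (- (INR i * b) + 2 * IZR (Z.of_nat i * t) * PI).
  2:{ rewrite mult_IZR, <- INR_IZR_INZ.
      transitivity (- (INR i * b) + INR i * (2 * IZR t * PI)); [ring|rewrite <- HM; ring]. }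
  rewrite !cos_Z_period, cos_0, cos_neg. field. lra.
Qed.

Definition log_sum (b : R) (M : nat) (r : R) : R :=
  bsum (fun i => (1 + cos (INR i * b)) * ln (1 + 2 * r * cos (INR i * b) + r ^ 2)) M.

Definition log_sum' (b : R) (M : nat) (r : R) : R :=
  bsum (fun i => (1 + cos (INR i * b)) * (2 * cos (INR i * b) + 2 * r)
                 / (1 + 2 * r * cos (INR i * b) + r ^ 2)) M.

Lemma is_derive_log_sum (b : R) (M : nat) (r : R) :
  0 <= r <= 1 -> is_derive (log_sum b M) r (log_sum' b M r).
Proof.
  intros Hr. unfold log_sum, log_sum'.
  apply (is_derive_bsum
    (fun i t => (1 + cos (INR i * b)) * ln (1 + 2 * t * cos (INR i * b) + t ^ 2))
    (fun i t => (1 + cos (INR i * b)) * (2 * cos (INR i * b) + 2 * t)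
                / (1 + 2 * t * cos (INR i * b) + t ^ 2))).
  intros i _. destruct (COS_bound (INR i * b)) as [Hc _].
  (* For [c = -1] the logarithm degenerates at [r = 1], but the factor [1 + c] makes the whole term
     identically zero. *)
  set (c := cos (INR i * b)) in *. destruct (Req_dec c (-1)) as [E|E].
  - apply (is_derive_ext (fun _ => 0)).
    + intros t. rewrite E. simpl. ring.
    + replace ((1 + c) * (2 * c + 2 * r) / (1 + 2 * r * c + r ^ 2)) with 0.
      * apply (is_derive_const (V := R_NormedModule) 0).
      * rewrite E. unfold Rdiv. ring.
  - assert (0 < 1 + 2 * r * c + r ^ 2).
    { assert (-1 < c) by lra. destruct (Rle_lt_dec r 0); nra. }
    auto_derive; [lra|field; lra].
Qed.

(** Polynomial division in the cosine splits each summand into a constant, a multiple of the cosine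
    and a multiple of the kernel; the cosines sum to zero. *)
Lemma log_sum'_eq (b : R) (M : nat) (r : R) :
  0 < r < 1 -> bsum (fun i => cos (INR i * b)) M = 0 ->
  log_sum' b M r = INR M + (1 - r) ^ 2 / r ^ 2 * (kernel_sum b M r - INR M).
Proof.
  intros Hr Hs. unfold log_sum'.
  rewrite (bsum_ext _ (fun i => (2 * r - 1) / r ^ 2 + (/ r * cos (INR i * b)
    + (1 - r) ^ 2 / r ^ 2
      * ((1 + r * cos (INR i * b)) / (1 + 2 * r * cos (INR i * b) + r ^ 2))))).
  - rewrite bsum_plus, bsum_plus, bsum_const, !bsum_scal, Hs.
    fold (kernel_sum b M r). field. lra.
  - intros i _.
    assert (HD := den_pos (cos (INR i * b)) r (proj1 (COS_bound _)) ltac:(lra)).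
    field. lra.
Qed.

(** The mean value theorem on [[0, 1]] replaces an integral of [F'] by its value at one point [r].
    Only the sign of [kernel_sum b M r - INR M] then matters. *)
Lemma bsum_xlnx_grid (b : R) (M : nat) :
  bsum (fun i => cos (INR i * b)) M = 0 ->
  exists r, 0 < r < 1 /\
    bsum (fun i => xlnx (1 + cos (INR i * b))) M
    = INR M * (1 - ln 2) + (1 - r) ^ 2 / r ^ 2 * (kernel_sum b M r - INR M).
Proof.
  intros Hs.
  destruct (MVT_cor2 (log_sum b M) (log_sum' b M) 0 1) as [r [E Hr]].
  - lra.
  - intros r Hr. apply is_derive_Reals. now apply is_derive_log_sum.
  - exists r. split; [lra|].
    rewrite log_sum'_eq in E by easy.
    assert (E0 : log_sum b M 0 = 0).
    { unfold log_sum. rewrite (bsum_ext _ (fun _ => 0)).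
      - rewrite bsum_const. ring.
      - intros i _. replace (1 + 2 * 0 * cos (INR i * b) + 0 ^ 2) with 1 by ring.
        rewrite ln_1. ring. }
    assert (E1 : log_sum b M 1
      = bsum (fun i => xlnx (1 + cos (INR i * b))) M + ln 2 * INR M).
    { replace (INR M) with (bsum (fun i => 1 + cos (INR i * b)) M).
      2:{ rewrite bsum_plus, bsum_const, Hs. ring. }
      rewrite <- bsum_scal, <- bsum_plus. unfold log_sum. apply bsum_ext. intros i _.
      unfold xlnx. destruct (COS_bound (INR i * b)) as [Hc _].
      destruct (Req_dec (1 + cos (INR i * b)) 0) as [E'|E'].
      - rewrite E'. ring.
      - replace (1 + 2 * 1 * cos (INR i * b) + 1 ^ 2) with (2 * (1 + cos (INR i * b))) by ring.
        rewrite ln_mult by lra. ring. }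
    lra.
Qed.

Lemma pow_neg_even (r : R) (m : nat) : Nat.Even m -> (- r) ^ m = r ^ m.
Proof.
  intros [l ->]. rewrite !pow_mult. f_equal. ring.
Qed.

Lemma pow_neg_odd (r : R) (m : nat) : Nat.Odd m -> (- r) ^ m = - r ^ m.
Proof.
  intros [l ->]. rewrite !pow_add, (pow_neg_even r (2 * l)) by (exists l; easy). ring.
Qed.

(** Shifting the index by [n] adds an odd multiple of [PI], so the terms cancel in pairs. *)
Lemma bsum_cos_odd_half_turns (a : R) (n : nat) (t : Z) :
  INR n * a = (2 * IZR t + 1) * PI -> bsum (fun i => cos (INR i * a)) (2 * n) = 0.
Proof.
  intros H. replace (2 * n)%nat with (n + n)%nat by lia. rewrite bsum_add, <- bsum_plus.
  rewrite (bsum_ext _ (fun _ => 0)); [rewrite bsum_const; ring|].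
  intros i _. rewrite plus_INR.
  replace ((INR n + INR i) * a) with ((INR i * a + PI) + 2 * IZR t * PI) by lra.
  rewrite cos_Z_period, neg_cos. ring.
Qed.

(** In the expansion of the kernel sum the term [m = 0] contributes [2 n], odd powers have
    coefficient 0, and even powers are nonnegative. Since [2 t + 1] and [n] may share a factor, the
    even coefficients need not vanish. *)
Lemma bsum_xlnx_even_grid (a : R) (n : nat) (t : Z) : (1 <= n)%nat ->
  INR n * a = (2 * IZR t + 1) * PI ->
  INR (2 * n) * (1 - ln 2) <= bsum (fun i => xlnx (1 + cos (INR i * a))) (2 * n).
Proof.
  intros Hn H.
  destruct (bsum_xlnx_grid a (2 * n)) as [r [Hr E]].
  { now apply (bsum_cos_odd_half_turns a n t). }
  rewrite E. clear E.
  assert (HM : INR (2 * n) * a = 2 * IZR (2 * t + 1) * PI).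
  { rewrite mult_INR, plus_IZR, mult_IZR. simpl (INR 2). lra. }
  assert (K := kernel_sum_eq a r (2 * n) (2 * t + 1) HM ltac:(lra)).
  assert (Hq : 0 < (- r) ^ (2 * n) < 1).
  { rewrite pow_neg_even by (exists n; easy). split; [apply pow_lt; lra|].
    apply pow_lt_1_compat; [lra|lia]. }
  assert (HA : INR (2 * n) <= (1 - (- r) ^ (2 * n)) * kernel_sum a (2 * n) r).
  { rewrite K. rewrite (bsum_recl_pred _ (2 * n)) by lia.
    rewrite (bsum_ext (fun i => cos (INR i * (INR 0 * a))) (fun _ => 1)).
    2:{ intros i _. replace (INR i * (INR 0 * a)) with 0 by (simpl; ring). apply cos_0. }
    rewrite bsum_const.
    assert (H0 : bsum (fun _ => 0) (2 * n - 1) <=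
      bsum (fun m => (- r) ^ S m * bsum (fun i => cos (INR i * (INR (S m) * a))) (2 * n))
        (2 * n - 1)).
    { apply bsum_le. intros m _.
      destruct (Nat.Even_or_Odd (S m)) as [He|Ho].
      - rewrite pow_neg_even by easy. apply Rmult_le_pos; [apply pow_le; lra|].
        apply (bsum_cos_grid_ge_0 _ _ (Z.of_nat (S m) * (2 * t + 1))).
        rewrite mult_IZR, <- INR_IZR_INZ.
        transitivity (INR (S m) * (INR (2 * n) * a)); [ring|rewrite HM; ring].
      - destruct Ho as [l Hl].
        (* The witness comes from [(2 l + 1) (2 t + 1) = 2 (2 l t + l + t) + 1]: odd multiples of
           the step still make odd numbers of half turns. *)
        rewrite (bsum_cos_odd_half_turns _ n (2 * Z.of_nat l * t + Z.of_nat l + t)); [lra|].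
        rewrite Hl. transitivity (INR (2 * l + 1) * (INR n * a)); [ring|].
        rewrite H, !plus_IZR, !mult_IZR, plus_INR, mult_INR, <- INR_IZR_INZ. simpl. ring. }
    rewrite bsum_const in H0. rewrite pow_O. lra. }
  assert (HN := pos_INR (2 * n)).
  assert (INR (2 * n) <= kernel_sum a (2 * n) r) by nra.
  assert (0 < (1 - r) ^ 2 / r ^ 2) by (apply Rdiv_lt_0_compat; nra).
  nra.
Qed.

(** A zero would make [k] divide [s * m], hence [m] by Gauss's lemma. *)
Lemma sin_half_ne_0 (m s k : nat) : (0 < m < k)%nat -> Nat.gcd s k = 1%nat ->
  sin (INR m * (2 * INR s * PI / INR k) / 2) <> 0.
Proof.
  intros Hm Hg Hs. destruct (sin_eq_0_0 _ Hs) as [z Hz].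
  assert (Hk : INR k <> 0) by (apply not_0_INR; lia).
  assert (E : INR m * INR s = IZR z * INR k).
  { apply (Rmult_eq_reg_r (PI / INR k)).
    - transitivity (INR m * (2 * INR s * PI / INR k) / 2); [field; easy|].
      rewrite Hz. field. easy.
    - pose proof PI_RGT_0. apply Rmult_integral_contrapositive_currified; [lra|].
      now apply Rinv_neq_0_compat. }
  rewrite !INR_IZR_INZ, <- !mult_IZR in E. apply eq_IZR in E.
  assert (Hd : Nat.divide k (s * m)).
  { apply Nat.Lcm0.mod_divide. apply Nat2Z.inj. rewrite Nat2Z.inj_mod, Nat2Z.inj_mul.
    rewrite Z.mul_comm, E. apply Z.mod_mul. lia. }
  apply Nat.gauss in Hd; [|now rewrite Nat.gcd_comm].
  apply Nat.divide_pos_le in Hd; lia.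
Qed.

(** Coprimality kills every coefficient with [0 < m < k], leaving
    [(1 + r ^ k) * kernel_sum b k r = INR k]; hence the strict inequality. *)
Lemma bsum_xlnx_odd_grid (s k : nat) : (1 < k)%nat -> Nat.Odd k -> Nat.gcd s k = 1%nat ->
  bsum (fun i => xlnx (1 + cos (INR i * (2 * INR s * PI / INR k)))) k
  < INR k * (1 - ln 2).
Proof.
  intros Hk Ho Hg. set (b := 2 * INR s * PI / INR k).
  assert (Hk0 : 0 < INR k) by (apply lt_0_INR; lia).
  assert (HM : INR k * b = 2 * IZR (Z.of_nat s) * PI).
  { unfold b. rewrite <- INR_IZR_INZ. field. lra. }
  assert (Hsum : forall m, (0 < m < k)%nat -> bsum (fun i => cos (INR i * (INR m * b))) k = 0).
  { intros m Hm. apply (bsum_cos_grid _ _ (Z.of_nat m * Z.of_nat s)).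
    - rewrite mult_IZR, <- (INR_IZR_INZ m).
      transitivity (INR m * (INR k * b)); [ring|rewrite HM; ring].
    - now apply sin_half_ne_0. }
  destruct (bsum_xlnx_grid b k) as [r [Hr E]].
  { rewrite <- (Hsum 1%nat) by lia. apply bsum_ext. intros i _. simpl. now rewrite Rmult_1_l. }
  rewrite E. clear E.
  assert (K := kernel_sum_eq b r k _ HM ltac:(lra)).
  assert (HA : (1 - (- r) ^ k) * kernel_sum b k r = INR k).
  { rewrite K. rewrite (bsum_recl_pred _ k) by lia.
    rewrite (bsum_ext (fun i => cos (INR i * (INR 0 * b))) (fun _ => 1)).
    2:{ intros i _. replace (INR i * (INR 0 * b)) with 0 by (simpl; ring). apply cos_0. }
    rewrite (bsum_ext (fun m => (- r) ^ S m * _) (fun _ => 0)).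
    2:{ intros m Hm. rewrite Hsum by lia. ring. }
    rewrite !bsum_const. simpl. ring. }
  rewrite pow_neg_odd in HA by easy.
  assert (Hq : 0 < r ^ k) by (apply pow_lt; lra).
  assert (kernel_sum b k r < INR k) by nra.
  assert (0 < (1 - r) ^ 2 / r ^ 2) by (apply Rdiv_lt_0_compat; nra).
  nra.
Qed.

(** * The function w ln w *)

Lemma ln_le_pred (x : R) : 0 < x -> ln x <= x - 1.
Proof. intros Hx. assert (H := exp_ineq1_le (ln x)). rewrite exp_ln in H; lra. Qed.

Lemma xlnx_bounds (x : R) : 0 <= x -> - 1 <= xlnx x <= x * (x - 1).
Proof.
  intros Hx. unfold xlnx. destruct (Req_dec x 0) as [->|Hx0]; [lra|].
  assert (H1 := ln_le_pred x ltac:(lra)).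
  assert (H2 := ln_le_pred (/ x) ltac:(apply Rinv_0_lt_compat; lra)).
  rewrite ln_Rinv in H2 by lra. split; [|nra].
  assert (x * - ln x <= x * (/ x - 1)) by (apply Rmult_le_compat_l; lra).
  replace (x * (/ x - 1)) with (1 - x) in H by (field; lra). lra.
Qed.

(** [ln] takes the default value 0 here, which makes the two-sided continuity at 0 true. *)
Lemma xlnx_neg (x : R) : x <= 0 -> xlnx x = 0.
Proof.
  intros Hx. unfold xlnx, ln. destruct (Rlt_dec 0 x) as [H|H]; [exfalso; lra|ring].
Qed.

(** With [u = sqrt x], [x ln x = 2 u (u ln u)], and [u ln u] lies in [[-1, 0]]. This controls [xlnx]
    near 0. *)
Lemma xlnx_abs_le_sqrt (x : R) : 0 <= x <= 1 -> Rabs (xlnx x) <= 2 * sqrt x.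
Proof.
  intros Hx. set (u := sqrt x).
  assert (Hu : 0 <= u) by apply sqrt_pos.
  assert (E : x = u * u) by (symmetry; apply sqrt_sqrt; lra).
  assert (Hu1 : u <= 1) by nra.
  assert (Ex : xlnx x = 2 * u * xlnx u).
  { unfold xlnx. destruct (Req_dec u 0) as [H0|H0].
    - rewrite E, H0. ring.
    - rewrite E, ln_mult by lra. ring. }
  assert (B := xlnx_bounds u Hu). rewrite Ex. apply Rabs_le. nra.
Qed.

Lemma continuity_pt_xlnx (x : R) : 0 <= x -> continuity_pt xlnx x.
Proof.
  intros Hx. destruct (Req_dec x 0) as [->|Hx0].
  - intros eps Heps. exists (Rmin 1 ((eps / 2) ^ 2)).
    assert (0 < (eps / 2) ^ 2) by (apply pow_lt; lra).
    split; [now apply Rmin_pos; try lra|].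
    intros y [_ Hy]. simpl in *. unfold R_dist in *.
    rewrite (xlnx_neg 0), Rminus_0_r in * by lra.
    destruct (Rle_lt_dec y 0) as [Hy0|Hy0].
    + rewrite xlnx_neg, Rabs_R0 by easy. easy.
    + rewrite (Rabs_right y) in Hy by lra.
      assert (H1 := Rmin_l 1 ((eps / 2) ^ 2)). assert (H2 := Rmin_r 1 ((eps / 2) ^ 2)).
      eapply Rle_lt_trans; [apply xlnx_abs_le_sqrt; simpl in *; lra|].
      assert (sqrt y < eps / 2); [|lra].
      rewrite <- (sqrt_pow2 (eps / 2)) by lra. apply sqrt_lt_1; simpl in *; lra.
  - apply continuity_pt_mult; [apply derivable_continuous_pt, derivable_pt_id|].
    apply derivable_continuous_pt. exists (/ x). apply derivable_pt_lim_ln. lra.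
Qed.

Lemma xlnx_unif_cont (eps : R) : 0 < eps ->
  exists delta, 0 < delta /\ forall x y, 0 <= x <= 2 -> 0 <= y <= 2 ->
    Rabs (x - y) < delta -> Rabs (xlnx x - xlnx y) < eps.
Proof.
  intros Heps.
  destruct (Heine_cor2 (f := xlnx) (a := 0) (b := 2)
    (fun x Hx => continuity_pt_xlnx x (proj1 Hx)) (mkposreal eps Heps)) as [d Hd].
  exists d. split; [apply cond_pos|exact Hd].
Qed.

(** * Weights proportional to the squared Chebyshev polynomials *)

Definition cheb_weight (c : cheb_kind) (theta : R) (i : nat) : R :=
  match c with
  | FirstKind => match i with O => 1 | _ => 1 + cos (INR i * (2 * theta)) end
  | SecondKind => 1 - cos (INR (S i) * (2 * theta))
  end.

Definition weight_sum (c : cheb_kind) (theta : R) (n : nat) : R :=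
  bsum (cheb_weight c theta) n.

Definition weight_xlnx_sum (c : cheb_kind) (theta : R) (n : nat) : R :=
  bsum (fun i => xlnx (cheb_weight c theta i)) n.

Lemma cheb_weight_range (c : cheb_kind) (theta : R) (i : nat) :
  0 <= cheb_weight c theta i <= 2.
Proof.
  destruct c; unfold cheb_weight.
  - destruct i; [lra|]. destruct (COS_bound (INR (S i) * (2 * theta))). lra.
  - destruct (COS_bound (INR (S i) * (2 * theta))). lra.
Qed.

(** The factor [K] does not depend on the index, so it cancels when the weights are normalized to
    probabilities. *)
Lemma cheb_weight_sqr (c : cheb_kind) (theta : R) : 0 < theta < PI ->
  exists K, 0 < K /\ forall i, cheb_weight c theta i = K * cheb_p c i (cos theta) ^ 2.
Proof.
  intros Ht. assert (HP := PI_RGT_0).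
  assert (Hs : 0 < sin theta) by (apply sin_gt_0; lra).
  assert (H2 : sqrt (2 / PI) ^ 2 = 2 / PI).
  { apply pow2_sqrt, Rlt_le, Rdiv_lt_0_compat; lra. }
  destruct c; unfold cheb_weight, cheb_p; rewrite acos_cos by lra.
  - exists PI. split; [easy|]. intros [|i].
    + rewrite pow_inv, pow2_sqrt by lra. field. lra.
    + rewrite Rpow_mult_distr, H2.
      replace (INR (S i) * (2 * theta)) with (2 * (INR (S i) * theta)) by ring.
      rewrite cos_2a_cos. field. lra.
  - exists (PI * sin theta ^ 2). split.
    { apply Rmult_lt_0_compat; [easy|now apply pow_lt]. }
    intros i. rewrite Rpow_mult_distr, H2.
    replace (INR (S i) * (2 * theta)) with (2 * (INR (S i) * theta)) by ring.
    rewrite cos_2a_sin. field. lra.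
Qed.

Lemma weight_sum_pos (c : cheb_kind) (theta : R) (n : nat) :
  0 < theta < PI -> (1 <= n)%nat -> 0 < weight_sum c theta n.
Proof.
  intros Ht Hn. unfold weight_sum. rewrite bsum_recl_pred by lia.
  apply Rplus_lt_le_0_compat.
  - destruct c; unfold cheb_weight; [lra|].
    replace (INR 1 * (2 * theta)) with (2 * theta) by (simpl; ring). rewrite cos_2a_sin.
    assert (0 < sin theta) by (apply sin_gt_0; lra). nra.
  - replace 0 with (bsum (fun _ => 0) (n - 1)) by (rewrite bsum_const; ring).
    apply bsum_le. intros i _. apply cheb_weight_range.
Qed.

Lemma entropy_weights (c : cheb_kind) (theta : R) (n : nat) :
  0 < theta < PI -> (1 <= n)%nat ->
  entropy c n (cos theta)
  = ln (weight_sum c theta n) - weight_xlnx_sum c theta n / weight_sum c theta n.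
Proof.
  intros Ht Hn. assert (HW := weight_sum_pos c theta n Ht Hn).
  destruct (cheb_weight_sqr c theta Ht) as [K [HK E]].
  set (W := weight_sum c theta n) in *.
  assert (EW : W = K * / christoffel c n (cos theta)).
  { unfold christoffel. rewrite Rinv_inv.
    rewrite sum_n_m_bsum by lia. replace (S (n - 1) - 0)%nat with n by lia. rewrite <- bsum_scal.
    unfold W, weight_sum. apply bsum_ext. intros i _. apply E. }
  assert (Hl : christoffel c n (cos theta) = K / W).
  (* As [/ 0] is 0, a vanishing Christoffel value would force [W = 0]. *)
  { assert (christoffel c n (cos theta) <> 0).
    { intros H0. rewrite H0, Rinv_0 in EW. lra. }
    rewrite EW. field. lra. }
  unfold entropy. rewrite sum_n_m_bsum by easy. replace (S n - 1)%nat with n by lia.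
  rewrite (bsum_ext _ (fun i => / W * xlnx (cheb_weight c theta i)
                                + - (ln W / W) * cheb_weight c theta i)).
  - rewrite bsum_plus, !bsum_scal. fold (weight_xlnx_sum c theta n).
    fold (weight_sum c theta n). fold W. field. lra.
  - intros i _. unfold Psi. replace (1 + i - 1)%nat with i by lia.
    replace (christoffel c n (cos theta) * cheb_p c i (cos theta) ^ 2)
      with (cheb_weight c theta i / W) by (rewrite Hl, E; field; lra).
    destruct (cheb_weight_range c theta i) as [Hw _]. unfold xlnx.
    destruct (Req_dec (cheb_weight c theta i) 0) as [H0|H0].
    + rewrite H0. field. lra.
    + rewrite ln_div by lra. field. lra.
Qed.

Lemma weight_sum_bounded (c : cheb_kind) (theta : R) : 0 < theta < PI ->
  exists C, forall n, Rabs (weight_sum c theta n - INR n) <= C.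
Proof.
  intros Ht. assert (Hs : 0 < sin theta) by (apply sin_gt_0; lra).
  assert (B : forall n, Rabs (bsum (fun i => cos (INR i * (2 * theta))) n) <= / sin theta).
  { intros n. assert (B := bsum_cos_bounded (2 * theta) n).
    replace (2 * theta / 2) with theta in B by field.
    rewrite (Rabs_right (sin theta)) in B by lra. apply B. lra. }
  (* The extra 1 accounts for the cosine of index 0, which neither family of weights contains. *)
  exists (1 + / sin theta). intros n. unfold weight_sum.
  assert (HI : 0 < / sin theta) by now apply Rinv_0_lt_compat.
  destruct c.
  - destruct n as [|n].
    + simpl. rewrite Rminus_0_r, Rabs_R0. lra.
    + rewrite bsum_recl. cbv beta iota delta [cheb_weight].
      rewrite bsum_plus, bsum_const, S_INR.
      specialize (B (S n)). rewrite bsum_recl, Rmult_0_l, cos_0 in B.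
      apply Rabs_le_between in B. apply Rabs_le_between. lra.
  - rewrite (bsum_ext _ (fun i => 1 + (-1) * cos (INR (S i) * (2 * theta)))).
    2:{ intros i _. unfold cheb_weight. ring. }
    rewrite bsum_plus, bsum_const, bsum_scal.
    specialize (B (S n)). rewrite bsum_recl, Rmult_0_l, cos_0 in B.
    apply Rabs_le_between in B. apply Rabs_le_between. lra.
Qed.

(** * Perturbation of the angle *)

Lemma is_lim_seq_0_of_le (u v : nat -> R) :
  eventually (fun m => Rabs (u m) <= v m) -> is_lim_seq v 0 -> is_lim_seq u 0.
Proof.
  intros H Hv. apply is_lim_seq_abs_0.
  apply (is_lim_seq_le_le_loc (fun _ => 0) _ v); [|apply is_lim_seq_const|easy].
  destruct H as [N HN]. exists N. intros m Hm. split; [apply Rabs_pos|now apply HN].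
Qed.

Lemma is_lim_seq_div_of_bounded (u : nat -> R) (mu C : R) (k : nat -> nat) :
  (forall n, Rabs (u n - INR n * mu) <= C) ->
  is_lim_seq (fun m => INR (k m)) p_infty ->
  is_lim_seq (fun m => u (k m) / INR (k m)) mu.
Proof.
  intros Hu Hk.
  assert (HI : is_lim_seq (fun m => C * / INR (k m)) 0).
  { replace (Finite 0) with (Rbar_mult C (Rbar_inv p_infty)).
    - apply is_lim_seq_scal_l. now apply is_lim_seq_inv.
    - simpl. f_equal. ring. }
  assert (H0 : is_lim_seq (fun m => u (k m) / INR (k m) - mu) 0).
  { apply (is_lim_seq_0_of_le _ (fun m => C * / INR (k m))); [|easy].
    apply is_lim_seq_spec in Hk. destruct (Hk 0) as [N HN]. exists N. intros m Hm.
    specialize (HN m Hm).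
    replace (u (k m) / INR (k m) - mu) with ((u (k m) - INR (k m) * mu) * / INR (k m))
      by (field; lra).
    rewrite Rabs_mult, (Rabs_right (/ INR (k m))).
    - apply Rmult_le_compat_r; [|easy]. now apply Rlt_le, Rinv_0_lt_compat.
    - now apply Rle_ge, Rlt_le, Rinv_0_lt_compat. }
  apply (is_lim_seq_ext (fun m => (u (k m) / INR (k m) - mu) + mu)); [intros; ring|].
  replace (Finite mu) with (Finite (0 + mu)) by (f_equal; ring).
  apply is_lim_seq_plus'; [easy|apply is_lim_seq_const].
Qed.

Lemma cos_lipschitz (x y : R) : Rabs (cos x - cos y) <= Rabs (x - y).
Proof.
  destruct (MVT_abs cos (fun t => - sin t) y x) as [t [-> _]].
  - intros t _. apply derivable_pt_lim_cos.
  - rewrite Rabs_Ropp. rewrite <- (Rmult_1_l (Rabs (x - y))) at 2.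
    apply Rmult_le_compat_r; [apply Rabs_pos|]. apply Rabs_le, SIN_bound.
Qed.

(** The first [n] weights involve only frequencies up to [n], so one bound serves for all of
    them. *)
Lemma cheb_weight_lipschitz (c : cheb_kind) (theta theta' : R) (n i : nat) : (i < n)%nat ->
  Rabs (cheb_weight c theta' i - cheb_weight c theta i)
  <= 2 * Rabs (INR n * (theta' - theta)).
Proof.
  intros Hi.
  assert (H : forall l, (l <= n)%nat ->
    Rabs (cos (INR l * (2 * theta')) - cos (INR l * (2 * theta)))
    <= 2 * Rabs (INR n * (theta' - theta))).
  { intros l Hl. eapply Rle_trans; [apply cos_lipschitz|].
    replace (INR l * (2 * theta') - INR l * (2 * theta))
      with (2 * (INR l * (theta' - theta))) by ring.
    rewrite !Rabs_mult, (Rabs_right 2), !(Rabs_right (INR _))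
      by (try apply Rle_ge; try apply pos_INR; lra).
    apply le_INR in Hl. assert (B := Rabs_pos (theta' - theta)). nra. }
  destruct c; unfold cheb_weight.
  - destruct i as [|i].
    + rewrite Rminus_diag, Rabs_R0. assert (B := Rabs_pos (INR n * (theta' - theta))). lra.
    + replace (_ - _) with (cos (INR (S i) * (2 * theta')) - cos (INR (S i) * (2 * theta)))
        by ring.
      apply H. lia.
  - replace (_ - _) with (- (cos (INR (S i) * (2 * theta')) - cos (INR (S i) * (2 * theta))))
      by ring.
    rewrite Rabs_Ropp. apply H. lia.
Qed.

Lemma weight_sum_lipschitz (c : cheb_kind) (theta theta' : R) (n : nat) :
  Rabs (weight_sum c theta' n - weight_sum c theta n)
  <= INR n * (2 * Rabs (INR n * (theta' - theta))).
Proof.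
  unfold weight_sum.
  replace (_ - _) with (bsum (fun i => cheb_weight c theta' i + -1 * cheb_weight c theta i) n).
  - apply bsum_abs_le. intros i Hi.
    replace (_ + _) with (cheb_weight c theta' i - cheb_weight c theta i) by ring.
    now apply cheb_weight_lipschitz.
  - rewrite bsum_plus, bsum_scal. ring.
Qed.

Lemma weight_xlnx_sum_perturb (c : cheb_kind) (theta : R) (n : nat -> nat) (th : nat -> R) :
  (forall m, (1 <= n m)%nat) ->
  is_lim_seq (fun m => INR (n m) * (th m - theta)) 0 ->
  is_lim_seq (fun m => weight_xlnx_sum c (th m) (n m) / INR (n m)
                       - weight_xlnx_sum c theta (n m) / INR (n m)) 0.
Proof.
  intros Hn Hth. apply is_lim_seq_spec. intros eps.
  destruct (xlnx_unif_cont (eps / 2)) as [d [Hd Hu]].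
  { assert (B := cond_pos eps). lra. }
  apply is_lim_seq_spec in Hth. destruct (Hth (mkposreal (d / 2) ltac:(lra))) as [N HN].
  exists N. intros m Hm. specialize (HN m Hm). simpl in HN. rewrite Rminus_0_r in *.
  assert (HI : 0 < INR (n m)) by (apply lt_0_INR; specialize (Hn m); lia).
  assert (B : Rabs (weight_xlnx_sum c (th m) (n m) - weight_xlnx_sum c theta (n m))
              <= INR (n m) * (eps / 2)).
  { unfold weight_xlnx_sum.
    replace (_ - _) with (bsum (fun i => xlnx (cheb_weight c (th m) i)
                                 + -1 * xlnx (cheb_weight c theta i)) (n m)).
    - apply bsum_abs_le. intros i Hi.
      replace (_ + _) with (xlnx (cheb_weight c (th m) i) - xlnx (cheb_weight c theta i)) by ring.
      apply Rlt_le, Hu; try apply cheb_weight_range.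
      eapply Rle_lt_trans; [now apply (cheb_weight_lipschitz c theta (th m) (n m))|]. lra.
    - rewrite bsum_plus, bsum_scal. ring. }
  replace (_ - _) with ((weight_xlnx_sum c (th m) (n m) - weight_xlnx_sum c theta (n m))
                        * / INR (n m)) by (field; lra).
  rewrite Rabs_mult, (Rabs_right (/ INR (n m)))
    by now apply Rle_ge, Rlt_le, Rinv_0_lt_compat.
  apply (Rmult_lt_reg_r (INR (n m))); [easy|].
  rewrite Rmult_assoc, Rinv_l by lra. assert (E := cond_pos eps). nra.
Qed.

Lemma weight_xlnx_sum_bounded (c : cheb_kind) (theta : R) (n : nat) :
  Rabs (weight_xlnx_sum c theta n) <= INR n * 2.
Proof.
  apply bsum_abs_le. intros i _. assert (H := cheb_weight_range c theta i).
  assert (B := xlnx_bounds _ (proj1 H)). apply Rabs_le. nra.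
Qed.

Lemma is_lim_seq_inv_1 (u : nat -> R) : is_lim_seq u 1 -> is_lim_seq (fun m => / u m) 1.
Proof.
  intros H. replace (Finite 1) with (Rbar_inv 1) by (simpl; f_equal; field).
  apply is_lim_seq_inv; [easy|]. intros E. injection E. lra.
Qed.

Lemma is_lim_seq_ln_1 (u : nat -> R) : is_lim_seq u 1 -> is_lim_seq (fun m => ln (u m)) 0.
Proof.
  intros H. rewrite <- ln_1. apply is_lim_seq_continuous; [|easy].
  apply derivable_continuous_pt. exists (/ 1). apply derivable_pt_lim_ln. lra.
Qed.

(** After division of both sums by [n] the terms [ln n] cancel. The mean weights [U], [U'] tend to
    1, while the means [V], [V'] of [w ln w] approach each other. *)
Lemma entropy_perturb (c : cheb_kind) (theta : R) (n : nat -> nat) (th : nat -> R) :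
  0 < theta < PI -> (forall m, 0 < th m < PI) -> (forall m, (1 <= n m)%nat) ->
  is_lim_seq (fun m => INR (n m)) p_infty ->
  is_lim_seq (fun m => INR (n m) * (th m - theta)) 0 ->
  is_lim_seq (fun m => entropy c (n m) (cos (th m)) - entropy c (n m) (cos theta)) 0.
Proof.
  intros Ht Hth Hn Hinf Hlim.
  assert (HI : forall m, 0 < INR (n m)) by (intros m; apply lt_0_INR; specialize (Hn m); lia).
  set (U := fun m => weight_sum c theta (n m) / INR (n m)).
  set (U' := fun m => weight_sum c (th m) (n m) / INR (n m)).
  set (V := fun m => weight_xlnx_sum c theta (n m) / INR (n m)).
  set (V' := fun m => weight_xlnx_sum c (th m) (n m) / INR (n m)).
  assert (HU : is_lim_seq U 1).
  { destruct (weight_sum_bounded c theta Ht) as [C HC].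
    apply (is_lim_seq_div_of_bounded (weight_sum c theta) 1 C n); [|easy].
    intros l. rewrite Rmult_1_r. apply HC. }
  assert (HU' : is_lim_seq U' 1).
  { apply (is_lim_seq_ext (fun m => (U' m - U m) + U m)); [intros; ring|].
    replace (Finite 1) with (Finite (0 + 1)) by (f_equal; ring).
    apply is_lim_seq_plus'; [|easy].
    apply (is_lim_seq_0_of_le _ (fun m => 2 * Rabs (INR (n m) * (th m - theta)))).
    - exists 0%nat. intros m _. specialize (HI m). unfold U, U'.
      replace (_ - _) with ((weight_sum c (th m) (n m) - weight_sum c theta (n m))
                            * / INR (n m)) by (field; lra).
      rewrite Rabs_mult, (Rabs_right (/ INR (n m)))
        by now apply Rle_ge, Rlt_le, Rinv_0_lt_compat.
      apply (Rmult_le_reg_r (INR (n m))); [easy|].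
      rewrite Rmult_assoc, Rinv_l, Rmult_1_r by lra.
      rewrite (Rmult_comm _ (INR (n m))). apply weight_sum_lipschitz.
    - replace (Finite 0) with (Rbar_mult 2 0) by (simpl; f_equal; ring).
      apply is_lim_seq_scal_l. now apply -> is_lim_seq_abs_0. }
  assert (HV : is_lim_seq (fun m => V' m - V m) 0) by now apply weight_xlnx_sum_perturb.
  assert (HVb : forall m, Rabs (V m) <= 2).
  { intros m. specialize (HI m). unfold V, Rdiv.
    rewrite Rabs_mult, (Rabs_right (/ INR (n m)))
      by now apply Rle_ge, Rlt_le, Rinv_0_lt_compat.
    apply (Rmult_le_reg_r (INR (n m))); [easy|].
    rewrite Rmult_assoc, Rinv_l, Rmult_1_r by lra.
    rewrite (Rmult_comm 2). apply weight_xlnx_sum_bounded. }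
  (* [V] is only known to be bounded, so [V' / U' - V / U] is split to have each part contain a
     factor tending to 0. *)
  apply (is_lim_seq_ext (fun m => (ln (U' m) - ln (U m))
           - ((V' m - V m) * / U' m + V m * (/ U' m - / U m)))).
  - intros m. specialize (HI m). rewrite !entropy_weights by auto. unfold U, U', V, V'.
    assert (P := weight_sum_pos c theta (n m) Ht (Hn m)).
    assert (P' := weight_sum_pos c (th m) (n m) (Hth m) (Hn m)).
    rewrite !ln_div by lra. field. lra.
  - replace (Finite 0) with (Finite ((0 - 0) - (0 * 1 + 0))) by (f_equal; ring).
    apply is_lim_seq_minus'; [apply is_lim_seq_minus'; now apply is_lim_seq_ln_1|].
    apply is_lim_seq_plus'; [apply is_lim_seq_mult'; [easy|now apply is_lim_seq_inv_1]|].
    apply (is_lim_seq_0_of_le _ (fun m => 2 * Rabs (/ U' m - / U m))).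
    + exists 0%nat. intros m _. rewrite Rabs_mult. apply Rmult_le_compat_r; [apply Rabs_pos|easy].
    + replace (Finite 0) with (Rbar_mult 2 0) by (simpl; f_equal; ring).
      apply is_lim_seq_scal_l. apply -> is_lim_seq_abs_0.
      replace (Finite 0) with (Finite (1 - 1)) by (f_equal; ring).
      apply is_lim_seq_minus'; now apply is_lim_seq_inv_1.
Qed.

(** Choosing, for each [m], a zero with [N = m] and [eps = 1 / (m + 1)] reduces the theorem's
    approximation claim to a Diophantine one. *)
Lemma entropy_approximation (c : cheb_kind) (theta : R) : 0 < theta < PI ->
  (forall (N : nat) (eps : R), 0 < eps -> exists (n j : nat) (th : R),
     (N <= n)%nat /\ (1 <= j <= n)%nat /\ cheb_zero c n j = cos th /\
     0 < th < PI /\ Rabs (INR n * (th - theta)) <= eps) ->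
  exists (nm jm : nat -> nat),
    is_lim_seq (fun m => INR (nm m)) p_infty /\
    (forall m, (1 <= jm m <= nm m)%nat) /\
    is_lim_seq (fun m => cheb_zero c (nm m) (jm m)) (cos theta) /\
    is_lim_seq (fun m => entropy_at_zero c (nm m) (jm m) - entropy c (nm m) (cos theta)) 0.
Proof.
  intros Ht H.
  destruct (functional_choice (fun (m : nat) (p : nat * nat * R) =>
    let '(n, j, th) := p in
    (m <= n)%nat /\ (1 <= j <= n)%nat /\ cheb_zero c n j = cos th /\
    0 < th < PI /\ Rabs (INR n * (th - theta)) <= / (INR m + 1))) as [f Hf].
  { intros m. destruct (H m (/ (INR m + 1))) as [n [j [th Hp]]].
    - apply Rinv_0_lt_compat, INRp1_pos.
    - now exists (n, j, th). }
  set (n := fun m => fst (fst (f m))). set (j := fun m => snd (fst (f m))).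
  set (th := fun m => snd (f m)).
  assert (P : forall m, (m <= n m)%nat /\ (1 <= j m <= n m)%nat /\
    cheb_zero c (n m) (j m) = cos (th m) /\ 0 < th m < PI /\
    Rabs (INR (n m) * (th m - theta)) <= / (INR m + 1)).
  { intros m. unfold n, j, th. specialize (Hf m). now destruct (f m) as [[n' j'] th']. }
  clearbody n j th. clear f Hf.
  assert (Hinf : is_lim_seq (fun m => INR (n m)) p_infty).
  { apply (is_lim_seq_le_p_loc INR); [|apply is_lim_seq_INR].
    exists 0%nat. intros m _. apply le_INR, P. }
  assert (Hinv : is_lim_seq (fun m => / (INR m + 1)) 0).
  { replace (Finite 0) with (Rbar_inv p_infty) by easy. apply is_lim_seq_inv; [|easy].
    apply (is_lim_seq_ext (fun m => INR (S m))); [intros; now rewrite S_INR|].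
    apply (is_lim_seq_incr_1 INR), is_lim_seq_INR. }
  assert (Hlim : is_lim_seq (fun m => INR (n m) * (th m - theta)) 0).
  { apply (is_lim_seq_0_of_le _ (fun m => / (INR m + 1))); [|easy].
    exists 0%nat. intros m _. apply P. }
  assert (Hn : forall m, (1 <= n m)%nat) by (intros m; specialize (P m); lia).
  exists n, j. split; [easy|]. split; [intros m; apply P|]. split.
  - apply (is_lim_seq_ext (fun m => (cos (th m) - cos theta) + cos theta)).
    { intros m. destruct (P m) as (_ & _ & -> & _). ring. }
    replace (Finite (cos theta)) with (Finite (0 + cos theta)) by (f_equal; ring).
    apply is_lim_seq_plus'; [|apply is_lim_seq_const].
    apply (is_lim_seq_0_of_le _ (fun m => / (INR m + 1))); [|easy].
    exists 0%nat. intros m _. eapply Rle_trans; [apply cos_lipschitz|].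
    eapply Rle_trans; [|apply P]. rewrite Rabs_mult.
    assert (1 <= INR (n m)) by apply (le_INR 1), Hn.
    rewrite (Rabs_right (INR (n m))) by lra.
    assert (B := Rabs_pos (th m - theta)). nra.
  - apply (is_lim_seq_ext (fun m => entropy c (n m) (cos (th m)) - entropy c (n m) (cos theta))).
    { intros m. unfold entropy_at_zero. now destruct (P m) as (_ & _ & -> & _). }
    apply entropy_perturb; try easy. intros m. apply P.
Qed.

(** * Zeros close to a given angle *)

Lemma real_euclid (x g : R) : 0 < g -> exists z : Z, 0 <= x - IZR z * g < g.
Proof.
  intros Hg. exists (Int_part (x / g)). destruct (base_Int_part (x / g)) as [H1 H2].
  assert (E : x = x / g * g) by (field; lra). split.
  - rewrite E at 1. nra.
  - rewrite E at 1. nra.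
Qed.

Definition irrational (alpha : R) : Prop :=
  ~ exists a b : Z, b <> 0%Z /\ alpha = IZR a / IZR b.

(* Reducing 1 and alpha modulo a positive element g of the group Z alpha + Z leaves a nonzero
   remainder rho for one of them, and rho or g - rho is at most g / 2. *)
Lemma small_integer_combination (alpha : R) (n : nat) : irrational alpha ->
  exists q p : Z, 0 < IZR q * alpha - IZR p <= (/ 2) ^ n.
Proof.
  intros Hirr. induction n as [|n [q [p IH]]].
  (* The descent starts from the group element 1. *)
  - exists 0%Z, (-1)%Z. simpl. lra.
  - set (g := IZR q * alpha - IZR p) in *.
    destruct (real_euclid 1 g (proj1 IH)) as [z1 H1].
    destruct (real_euclid alpha g (proj1 IH)) as [z2 H2].
    assert (Hex : exists u v : Z, 0 < IZR u * alpha - IZR v < g).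
    { destruct (Rle_lt_dec (1 - IZR z1 * g) 0) as [E1|E1].
      - destruct (Rle_lt_dec (alpha - IZR z2 * g) 0) as [E2|E2].
        (* Both remainders vanish, so [1 = z1 g] and [alpha = z2 g], making [alpha] rational. *)
        + exfalso. apply Hirr. exists z2, z1.
          assert (Hz : IZR z1 <> 0) by (intros E; rewrite E in E1; lra).
          split; [intros ->; lra|].
          assert (Eg : g = / IZR z1) by (apply (Rmult_eq_reg_l (IZR z1)); [rewrite Rinv_r|]; lra).
          unfold Rdiv. rewrite <- Eg. lra.
        + exists (1 - z2 * q)%Z, (- (z2 * p))%Z.
          rewrite minus_IZR, opp_IZR, !mult_IZR. unfold g in *. lra.
      - exists (- (z1 * q))%Z, (- (1 + z1 * p))%Z.
        rewrite !opp_IZR, plus_IZR, !mult_IZR. unfold g in *. lra. }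
    destruct Hex as [u [v Huv]]. simpl.
    destruct (Rle_lt_dec (IZR u * alpha - IZR v) (g / 2)) as [Hh|Hh].
    + exists u, v. lra.
    + exists (q - u)%Z, (p - v)%Z. rewrite !minus_IZR. unfold g in *. lra.
Qed.

(** Increasing [n] by [|q|] moves [n alpha - beta] modulo 1 by the small amount [d], in the
    direction given by the sign of [q]; steps of this size cannot jump over the neighbourhood of an
    integer. *)
Lemma kronecker (alpha beta eps : R) (N : nat) : irrational alpha -> 0 < eps ->
  exists (n : nat) (J : Z), (N <= n)%nat /\ Rabs (INR n * alpha - beta - IZR J) < eps.
Proof.
  intros Hirr Heps.
  destruct (pow_lt_1_zero (/ 2) ltac:(rewrite Rabs_right; lra) (Rmin eps 1)
              ltac:(apply Rmin_pos; lra)) as [k Hk].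
  specialize (Hk k (le_n k)).
  rewrite Rabs_right in Hk by (apply Rle_ge, pow_le; lra).
  destruct (small_integer_combination alpha k Hirr) as [q [p Hqp]].
  set (d := IZR q * alpha - IZR p) in *.
  assert (M1 := Rmin_l eps 1). assert (M2 := Rmin_r eps 1).
  (* Otherwise [d] would be an integer strictly between 0 and 1; the minimum with 1 excludes
     this. *)
  assert (Hq : (q <> 0)%Z).
  { intros ->. unfold d in Hqp. rewrite Rmult_0_l in Hqp.
    assert (IZR (- p) < 1) by (rewrite opp_IZR; lra).
    assert (0 < IZR (- p)) by (rewrite opp_IZR; lra).
    apply lt_IZR in H. apply lt_IZR in H0. lia. }
  destruct (Z.lt_trichotomy q 0) as [Hneg|[H0|Hpos]]; [|easy|].
  (* For negative [q] the steps descend, so the target is the integer below; in the other case it is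
     the integer above. *)
  - set (J0 := Int_part (INR N * alpha - beta)).
    destruct (base_Int_part (INR N * alpha - beta)) as [B1 _]. fold J0 in B1.
    destruct (real_euclid (INR N * alpha - beta - IZR J0) d (proj1 Hqp)) as [l Hl].
    assert (Hl0 : (0 <= l)%Z).
    { apply Z.lt_succ_r. apply lt_IZR. rewrite succ_IZR. nra. }
    exists (N + Z.to_nat (l * - q))%nat, (J0 - l * p)%Z. split; [lia|].
    rewrite plus_INR, (INR_IZR_INZ (Z.to_nat _)), Z2Nat.id by nia.
    rewrite minus_IZR, !mult_IZR, opp_IZR. apply Rabs_lt_between. unfold d in *. nra.
  - set (J0 := up (INR N * alpha - beta)).
    destruct (archimed (INR N * alpha - beta)) as [B1 _]. fold J0 in B1.
    destruct (real_euclid (IZR J0 - (INR N * alpha - beta)) d (proj1 Hqp)) as [l Hl].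
    assert (Hl0 : (0 <= l)%Z).
    { apply Z.lt_succ_r. apply lt_IZR. rewrite succ_IZR. nra. }
    exists (N + Z.to_nat (l * q))%nat, (J0 + l * p)%Z. split; [lia|].
    rewrite plus_INR, (INR_IZR_INZ (Z.to_nat _)), Z2Nat.id by nia.
    rewrite plus_IZR, !mult_IZR. apply Rabs_lt_between. unfold d in *. nra.
Qed.

(* The zero of index [j = J + 1] has angle [(J + 1/2) PI / n]. *)
Lemma first_kind_near_zero (alpha eps : R) (n : nat) (J : Z) :
  0 < alpha < 1 -> 0 < eps -> (1 <= n)%nat ->
  Rabs (INR n * alpha - / 2 - IZR J) < Rmin (/ 2) (eps / PI) ->
  exists (j : nat) (th : R), (1 <= j <= n)%nat /\ cheb_zero FirstKind n j = cos th /\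
    0 < th < PI /\ Rabs (INR n * (th - alpha * PI)) <= eps.
Proof.
  intros Ha Heps Hn HJ. assert (HP := PI_RGT_0).
  assert (Hn1 : 1 <= INR n) by now apply (le_INR 1).
  assert (M1 := Rmin_l (/ 2) (eps / PI)). assert (M2 := Rmin_r (/ 2) (eps / PI)).
  assert (B := HJ). apply Rabs_lt_between in B.
  (* Tolerance [1/2] gives [n alpha - 1 < J < n alpha], so [J + 1] is an admissible index. *)
  assert (H0 : (0 <= J)%Z).
  { apply Z.lt_succ_r, lt_IZR. rewrite succ_IZR. nra. }
  assert (H1 : (J < Z.of_nat n)%Z).
  { apply lt_IZR. rewrite <- INR_IZR_INZ. nra. }
  apply IZR_le in H0.
  assert (H2 : IZR J + 1 <= INR n).
  { rewrite INR_IZR_INZ, <- plus_IZR. apply IZR_le. lia. }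
  exists (Z.to_nat (J + 1)), ((IZR J + / 2) / INR n * PI).
  assert (Hr : 0 < (IZR J + / 2) / INR n < 1).
  { split; [apply Rdiv_lt_0_compat; lra|].
    apply (Rmult_lt_reg_r (INR n)); [lra|]. unfold Rdiv.
    rewrite Rmult_assoc, Rinv_l; lra. }
  split; [apply le_IZR in H0; lia|]. split; [|split].
  - unfold cheb_zero. f_equal. apply le_IZR in H0.
    rewrite (INR_IZR_INZ (Z.to_nat _)), Z2Nat.id, plus_IZR by lia. field. lra.
  - nra.
  - replace (INR n * ((IZR J + / 2) / INR n * PI - alpha * PI))
      with (- ((INR n * alpha - / 2 - IZR J) * PI)) by (field; lra).
    rewrite Rabs_Ropp, Rabs_mult, (Rabs_right PI) by lra.
    replace eps with (eps / PI * PI) by (field; lra). apply Rmult_le_compat_r; lra.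
Qed.

(** The zero of index [J] has angle [J PI / (n + 1)]. The tolerances [alpha] and [1 - alpha] yield
    [n alpha < J < n alpha + 1], hence [1 <= J <= n]. *)
Lemma second_kind_near_zero (alpha eps : R) (n : nat) (J : Z) :
  0 < alpha < 1 -> 0 < eps -> (1 <= n)%nat ->
  Rabs (INR (S n) * alpha - IZR J) < Rmin (Rmin alpha (1 - alpha)) (eps / PI) ->
  exists (j : nat) (th : R), (1 <= j <= n)%nat /\ cheb_zero SecondKind n j = cos th /\
    0 < th < PI /\ Rabs (INR n * (th - alpha * PI)) <= eps.
Proof.
  intros Ha Heps Hn HJ. assert (HP := PI_RGT_0).
  rewrite S_INR in HJ.
  assert (Hn1 : 1 <= INR n) by now apply (le_INR 1).
  assert (M1 := Rmin_l (Rmin alpha (1 - alpha)) (eps / PI)).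
  assert (M2 := Rmin_r (Rmin alpha (1 - alpha)) (eps / PI)).
  assert (M3 := Rmin_l alpha (1 - alpha)). assert (M4 := Rmin_r alpha (1 - alpha)).
  assert (B := HJ). apply Rabs_lt_between in B.
  assert (H0 : (1 <= J)%Z).
  { enough (0 < J)%Z by lia. apply lt_IZR. nra. }
  assert (H1 : (J <= Z.of_nat n)%Z).
  { apply Z.lt_succ_r, lt_IZR. rewrite succ_IZR, <- INR_IZR_INZ. nra. }
  assert (H2 : IZR J <= INR n) by (rewrite INR_IZR_INZ; now apply IZR_le).
  assert (H3 : 1 <= IZR J) by now apply IZR_le.
  exists (Z.to_nat J), (IZR J / (INR n + 1) * PI).
  assert (Hr : 0 < IZR J / (INR n + 1) < 1).
  { split; [apply Rdiv_lt_0_compat; lra|].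
    apply (Rmult_lt_reg_r (INR n + 1)); [lra|]. unfold Rdiv.
    rewrite Rmult_assoc, Rinv_l; lra. }
  split; [lia|]. split; [|split].
  - unfold cheb_zero. f_equal.
    rewrite (INR_IZR_INZ (Z.to_nat _)), Z2Nat.id by lia. field. lra.
  - nra.
  - replace (INR n * (IZR J / (INR n + 1) * PI - alpha * PI))
      with (- (INR n / (INR n + 1) * (((INR n + 1) * alpha - IZR J) * PI))) by (field; lra).
    rewrite Rabs_Ropp, !Rabs_mult, (Rabs_right PI) by lra.
    assert (Hq : 0 <= INR n / (INR n + 1) <= 1).
    { split; [apply Rlt_le, Rdiv_lt_0_compat; lra|].
      apply (Rmult_le_reg_r (INR n + 1)); [lra|]. unfold Rdiv.
      rewrite Rmult_assoc, Rinv_l; lra. }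
    rewrite (Rabs_right (INR n / (INR n + 1))) by lra.
    assert (E : Rabs ((INR n + 1) * alpha - IZR J) * PI <= eps / PI * PI)
      by (apply Rmult_le_compat_r; lra).
    replace (eps / PI * PI) with eps in E by (field; lra).
    assert (0 <= Rabs ((INR n + 1) * alpha - IZR J) * PI)
      by (apply Rmult_le_pos; [apply Rabs_pos|lra]).
    nra.
Qed.

(** * The gap for odd denominators *)

(** Reflection about index [n] preserves the cosines, so the second half mirrors the first, with
    index [n] in place of index 0. This carries facts about the [2 n]-point grid over to the [n]
    weights at a zero. *)
Lemma bsum_fold_half_turns (h : R -> R) (a : R) (n : nat) (t : Z) :
  (1 <= n)%nat -> INR n * a = (2 * IZR t + 1) * PI ->
  bsum (fun i => h (cos (INR i * a))) (2 * n)
  = 2 * bsum (fun i => h (cos (INR i * a))) n - h 1 + h (-1).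
Proof.
  intros Hn H. replace (2 * n)%nat with (n + n)%nat by lia. rewrite bsum_add.
  rewrite (bsum_ext (fun i => h (cos (INR (n + i) * a)))
                    (fun i => h (cos (INR (n - i) * a)))).
  - rewrite (bsum_rev (fun i => h (cos (INR i * a)))).
    assert (E := bsum_recl (fun i => h (cos (INR i * a))) n).
    simpl bsum in E at 1. rewrite H, Rmult_0_l, cos_0 in E.
    replace ((2 * IZR t + 1) * PI) with (PI + 2 * IZR t * PI) in E by ring.
    rewrite cos_Z_period, cos_PI in E. lra.
  - intros i Hi. f_equal. rewrite plus_INR, minus_INR by lia.
    rewrite Rmult_plus_distr_r, Rmult_minus_distr_r, H.
    replace ((2 * IZR t + 1) * PI + INR i * a)
      with ((INR i * a + PI) + 2 * IZR t * PI) by ring.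
    replace ((2 * IZR t + 1) * PI - INR i * a)
      with ((- (INR i * a) + PI) + 2 * IZR t * PI) by ring.
    now rewrite !cos_Z_period, !neg_cos, cos_neg.
Qed.

(* The weight of index 0 is 1 where the periodic pattern would give 2. *)
Lemma weight_sum_first_kind (theta : R) (n : nat) : (1 <= n)%nat ->
  weight_sum FirstKind theta n
  = bsum (fun i => 1 + cos (INR i * (2 * theta))) n - 1.
Proof.
  intros Hn. unfold weight_sum. rewrite !(bsum_recl_pred _ n) by lia.
  cbv beta iota delta [cheb_weight]. rewrite Rmult_0_l, cos_0. ring.
Qed.

Lemma weight_xlnx_sum_first_kind (theta : R) (n : nat) : (1 <= n)%nat ->
  weight_xlnx_sum FirstKind theta n
  = bsum (fun i => xlnx (1 + cos (INR i * (2 * theta)))) n - 2 * ln 2.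
Proof.
  intros Hn. unfold weight_xlnx_sum. rewrite !(bsum_recl_pred _ n) by lia.
  cbv beta iota delta [cheb_weight]. rewrite Rmult_0_l, cos_0.
  replace (1 + 1) with 2 by ring. unfold xlnx at 1 3. rewrite ln_1. ring.
Qed.

(** At a zero the weights sum to exactly [n], and the even-grid bound applies to their [w ln w]. The
    term [ln 2 / n] collects the exceptional weight of index 0 and the endpoints of the folding; the
    bound is uniform in [j]. *)
Lemma entropy_at_first_kind_zero_le (n j : nat) : (1 <= j <= n)%nat ->
  entropy_at_zero FirstKind n j <= ln (INR n) - (1 - ln 2) + ln 2 / INR n.
Proof.
  intros Hj. assert (HP := PI_RGT_0).
  assert (Hn : 1 <= INR n) by (apply (le_INR 1); lia).
  assert (Hj1 : 1 <= INR j) by (apply (le_INR 1); lia).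
  assert (Hjn : INR j <= INR n) by (apply le_INR; lia).
  unfold entropy_at_zero, cheb_zero.
  set (th := (2 * INR j - 1) * PI / (2 * INR n)).
  assert (Hth : 0 < th < PI).
  { unfold th. split; [apply Rdiv_lt_0_compat; nra|].
    apply (Rmult_lt_reg_r (2 * INR n)); [lra|]. unfold Rdiv.
    rewrite Rmult_assoc, Rinv_l by lra. nra. }
  assert (Ha : INR n * (2 * th) = (2 * IZR (Z.of_nat j - 1) + 1) * PI).
  { rewrite minus_IZR, <- INR_IZR_INZ. unfold th. field. lra. }
  rewrite entropy_weights by (easy || lia).
  rewrite weight_sum_first_kind, weight_xlnx_sum_first_kind by lia.
  assert (E1 := bsum_fold_half_turns (fun c => 1 + c) (2 * th) n _ ltac:(lia) Ha).
  rewrite bsum_plus, bsum_const, (bsum_cos_odd_half_turns _ n _ Ha), mult_INR in E1.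
  simpl (INR 2) in E1.
  assert (E2 := bsum_fold_half_turns (fun c => xlnx (1 + c)) (2 * th) n _ ltac:(lia) Ha).
  cbv beta in E1, E2.
  assert (E3 := bsum_xlnx_even_grid (2 * th) n _ ltac:(lia) Ha).
  rewrite mult_INR in E3. simpl (INR 2) in E3. rewrite E2 in E3. clear E2.
  replace (1 + -1) with 0 in * by ring. replace (1 + 1) with 2 in * by ring.
  rewrite (xlnx_neg 0) in E3 by lra. unfold xlnx at 2 in E3.
  replace (_ - 1) with (INR n) by lra.
  set (G := bsum (fun i => xlnx _) n) in *.
  assert ((1 - ln 2) - ln 2 / INR n <= (G - 2 * ln 2) / INR n); [|lra].
  apply (Rmult_le_reg_r (INR n)); [lra|]. field_simplify; [|lra|lra]. lra.
Qed.

(** The deviation [bsum f n - INR n * mu] is itself periodic in [n], hence takes finitely many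
    values. *)
Lemma bsum_periodic_bounded (f : nat -> R) (k : nat) (mu : R) : (1 <= k)%nat ->
  (forall i, f (k + i)%nat = f i) -> bsum f k = INR k * mu ->
  exists C, forall n, Rabs (bsum f n - INR n * mu) <= C.
Proof.
  intros Hk Hper Hmean. set (e := fun n => bsum f n - INR n * mu).
  assert (Hb : forall N, exists C, forall n, (n < N)%nat -> Rabs (e n) <= C).
  { induction N as [|N [C HC]]; [exists 0; lia|].
    exists (Rmax C (Rabs (e N))). intros n Hn.
    destruct (Nat.eq_dec n N) as [->|Hne]; [apply Rmax_r|].
    eapply Rle_trans; [apply HC; lia|apply Rmax_l]. }
  destruct (Hb k) as [C HC]. exists C. intros n. change (Rabs (e n) <= C).
  induction n as [n IH] using lt_wf_ind.
  destruct (Nat.lt_ge_cases n k) as [Hn|Hn]; [now apply HC|].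
  replace (e n) with (e (n - k)%nat); [apply IH; lia|].
  unfold e. replace (bsum f n) with (bsum f (k + (n - k))) by (f_equal; lia).
  rewrite bsum_add, Hmean, minus_INR by easy.
  rewrite (bsum_ext (fun i => f (k + i)%nat) f) by auto. ring.
Qed.

(** The entropy at [cos theta] is [ln n - mu + o(1)], where [mu < 1 - ln 2] is the odd-grid mean; at
    any zero it is at most [ln n - (1 - ln 2) + o(1)]. *)
Lemma first_kind_odd_entropy_gap (theta : R) (s k : nat) (j : nat -> nat) :
  0 < theta < PI -> (1 < k)%nat -> Nat.gcd s k = 1%nat -> Nat.Odd k ->
  theta = INR s * PI / INR k ->
  (forall n, (1 <= n)%nat -> (1 <= j n <= n)%nat) ->
  Rbar_lt (LimSup_seq (fun n => entropy_at_zero FirstKind n (j n)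
                                - entropy FirstKind n (cos theta))) 0.
Proof.
  intros Ht Hk Hg Ho Etheta Hj.
  assert (Hk0 : 0 < INR k) by (apply lt_0_INR; lia).
  set (G := fun n => bsum (fun i => xlnx (1 + cos (INR i * (2 * theta)))) n).
  set (mu := G k / INR k).
  assert (Hmu : mu < 1 - ln 2).
  { apply (Rmult_lt_reg_r (INR k)); [easy|]. unfold mu, Rdiv.
    rewrite Rmult_assoc, Rinv_l, Rmult_1_r, (Rmult_comm _ (INR k)) by lra.
    unfold G. replace (2 * theta) with (2 * INR s * PI / INR k) by (rewrite Etheta; field; lra).
    now apply bsum_xlnx_odd_grid. }
  assert (HG : exists C, forall n, Rabs (G n - INR n * mu) <= C).
  { apply (bsum_periodic_bounded _ k); [lia| |].
    - intros i. f_equal. f_equal. rewrite plus_INR, Rmult_plus_distr_r.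
      rewrite <- (cos_Z_period (INR i * (2 * theta)) (Z.of_nat s)). f_equal.
      rewrite <- INR_IZR_INZ, Etheta. field. lra.
    - unfold mu. fold (G k). field. lra. }
  destruct HG as [C HC]. destruct (weight_sum_bounded FirstKind theta Ht) as [C' HC'].
  set (U := fun n => weight_sum FirstKind theta n / INR n).
  set (V := fun n => weight_xlnx_sum FirstKind theta n / INR n).
  assert (HU : is_lim_seq U 1).
  { apply (is_lim_seq_div_of_bounded (weight_sum FirstKind theta) 1 C' (fun n => n));
      [|apply is_lim_seq_INR]. intros n. rewrite Rmult_1_r. apply HC'. }
  assert (HV : is_lim_seq V mu).
  { apply (is_lim_seq_div_of_bounded (weight_xlnx_sum FirstKind theta) mu
             (C + 2 * ln 2) (fun n => n)); [|apply is_lim_seq_INR].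
    assert (Hl : 0 < ln 2) by (rewrite <- ln_1; apply ln_increasing; lra).
    intros n. specialize (HC n). destruct n as [|n].
    - unfold weight_xlnx_sum, G in *. simpl in *. lra.
    - rewrite weight_xlnx_sum_first_kind by lia. fold (G (S n)).
      apply Rabs_le_between in HC. apply Rabs_le_between. lra. }
  (* [v] bounds the entropy difference from above, with [ln n] already cancelled. *)
  set (v := fun n => (- (1 - ln 2) + ln 2 * / INR n) - (ln (U n) - V n * / U n)).
  assert (Hv : is_lim_seq v (mu - (1 - ln 2))).
  { replace (Finite (mu - (1 - ln 2)))
      with (Finite ((- (1 - ln 2) + ln 2 * 0) - (0 - mu * 1))) by (f_equal; ring).
    apply is_lim_seq_minus'; [apply is_lim_seq_plus'; [apply is_lim_seq_const|]|].
    - apply is_lim_seq_mult'; [apply is_lim_seq_const|].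
      replace (Finite 0) with (Rbar_inv p_infty) by easy.
      apply is_lim_seq_inv; [apply is_lim_seq_INR|easy].
    - apply is_lim_seq_minus'; [now apply is_lim_seq_ln_1|].
      apply is_lim_seq_mult'; [easy|now apply is_lim_seq_inv_1]. }
  apply (Rbar_le_lt_trans _ (LimSup_seq v)).
  - apply LimSup_le. exists 1%nat. intros n Hn.
    assert (Hn0 : 0 < INR n) by (apply lt_0_INR; lia).
    assert (HZ := entropy_at_first_kind_zero_le n (j n) (Hj n Hn)).
    assert (HW := weight_sum_pos FirstKind theta n Ht Hn).
    rewrite entropy_weights by easy. unfold v, U, V.
    rewrite ln_div by lra.
    replace (weight_xlnx_sum FirstKind theta n / INR n * / (weight_sum FirstKind theta n / INR n))
      with (weight_xlnx_sum FirstKind theta n / weight_sum FirstKind theta n) by (field; lra).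
    unfold Rdiv in *. lra.
  - rewrite (is_LimSup_seq_unique v (mu - (1 - ln 2))) by now apply is_lim_LimSup_seq.
    simpl. lra.
Qed.

(** * Irrational and rational angles *)

Theorem theorem2 (theta : R) (Htheta : 0 < theta < PI) :
  let x := cos theta in
  let approx (c : cheb_kind) :=
    exists (nm jm : nat -> nat),
      is_lim_seq (fun m => INR (nm m)) p_infty /\
      (forall m, (1 <= jm m <= nm m)%nat) /\
      is_lim_seq (fun m => cheb_zero c (nm m) (jm m)) x /\
      is_lim_seq (fun m => entropy_at_zero c (nm m) (jm m) - entropy c (nm m) x) 0 in
  (* (i) theta/pi irrational *)
  ((~ exists (a b : Z), b <> 0%Z /\ theta / PI = IZR a / IZR b) ->
     forall c : cheb_kind, approx c) /\
  (* (ii) theta/pi = s/k in lowest terms *)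
  (forall s k : nat, (s < k)%nat -> Nat.gcd s k = 1%nat ->
     theta / PI = INR s / INR k ->
     (forall c : cheb_kind, (c = SecondKind \/ Nat.Even k) -> approx c) /\
     (Nat.Odd k ->
        forall j : nat -> nat, (forall n, (1 <= n)%nat -> (1 <= j n <= n)%nat) ->
          Rbar_lt
            (LimSup_seq (fun n => entropy_at_zero FirstKind n (j n)
                                  - entropy FirstKind n x))
            (Finite 0))).
Proof.
  intros x approx. assert (HP := PI_RGT_0). set (alpha := theta / PI).
  assert (Etheta : theta = alpha * PI) by (unfold alpha; field; lra).
  assert (Ha : 0 < alpha < 1) by nra.
  (* Zeros of the first kind require [n alpha] near half-integers; those of the second require
     [(n + 1) alpha] near integers. *)
  assert (Hfirst : (forall (N : nat) (eps : R), 0 < eps -> exists (n : nat) (J : Z),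
    (N <= n)%nat /\ Rabs (INR n * alpha - / 2 - IZR J) < eps) -> approx FirstKind).
  { intros H. apply entropy_approximation; [easy|]. intros N eps Heps.
    assert (0 < eps / PI) by (apply Rdiv_lt_0_compat; lra).
    destruct (H (S N) (Rmin (/ 2) (eps / PI))) as [n [J [Hn HJ]]].
    { apply Rmin_pos; lra. }
    destruct (first_kind_near_zero alpha eps n J Ha Heps ltac:(lia) HJ) as [j [th Hj]].
    exists n, j, th. rewrite Etheta. split; [lia|easy]. }
  assert (Hsecond : (forall (N : nat) (eps : R), 0 < eps -> exists (n : nat) (J : Z),
    (N <= n)%nat /\ Rabs (INR n * alpha - IZR J) < eps) -> approx SecondKind).
  { intros H. apply entropy_approximation; [easy|]. intros N eps Heps.
    assert (0 < eps / PI) by (apply Rdiv_lt_0_compat; lra).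
    destruct (H (S (S N)) (Rmin (Rmin alpha (1 - alpha)) (eps / PI))) as [[|n] [J [Hn HJ]]].
    { repeat apply Rmin_pos; lra. }
    { lia. }
    destruct (second_kind_near_zero alpha eps n J Ha Heps ltac:(lia) HJ) as [j [th Hj]].
    exists n, j, th. rewrite Etheta. split; [lia|easy]. }
  split.
  - intros Hirr c. destruct c.
    + apply Hfirst. intros N eps Heps. now apply kronecker.
    + apply Hsecond. intros N eps Heps.
      destruct (kronecker alpha 0 eps N Hirr Heps) as [n [J HJ]].
      exists n, J. now rewrite Rminus_0_r in HJ.
  - intros s k Hsk Hg Ek.
    assert (Hk : 0 < INR k) by (apply lt_0_INR; lia).
    assert (Hs : (s <> 0)%nat).
    { intros ->. simpl in Ek. unfold Rdiv in Ek. rewrite Rmult_0_l in Ek. lra. }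
    split.
    + assert (H2 : approx SecondKind).
      { apply Hsecond. intros N eps Heps.
        (* [k N alpha = s N] is an integer: [theta] is itself the angle of a zero. *)
        exists (k * N)%nat, (Z.of_nat (s * N)). split; [nia|].
        rewrite Ek, <- INR_IZR_INZ, !mult_INR.
        replace (_ - _) with 0 by (field; lra). now rewrite Rabs_R0. }
      intros c Hc. destruct c; [|easy]. destruct Hc as [Hc|[h Hh]]; [easy|].
      assert (Ho : Nat.Odd s).
      { destruct (Nat.Even_or_Odd s) as [[u Hu]|Ho]; [|easy].
        assert (Hd : Nat.divide 2 (Nat.gcd s k)).
        { apply Nat.gcd_greatest; [exists u|exists h]; lia. }
        rewrite Hg in Hd. apply Nat.divide_pos_le in Hd; lia. }
      destruct Ho as [u Hu].
      apply Hfirst. intros N eps Heps.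
      (* With [k = 2 h] and [s = 2 u + 1], an odd multiple of [h] makes
         [n alpha = (2 N + 1) (2 u + 1) / 2] exactly a half-integer. *)
      exists (h * (2 * N + 1))%nat, (Z.of_nat (2 * N * u + N + u)). split; [nia|].
      rewrite Ek, <- INR_IZR_INZ, Hu, Hh.
      assert (Hh0 : 0 < INR h) by (apply lt_0_INR; lia).
      rewrite !plus_INR, !mult_INR, !plus_INR, !mult_INR. simpl (INR 2). simpl (INR 1).
      replace (_ - _) with 0 by (field; lra). now rewrite Rabs_R0.
    + intros Ho j Hj. apply (first_kind_odd_entropy_gap theta s k); try easy; [lia|].
      rewrite Etheta, Ek. field. lra.
Qed.
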